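(* Let $G$ and $H$ be groups acting on themselves and on each other fully compatibly, and set $\overline{G}=G/D_\rho(G)$. Let $\phi\colon G\boxtimes H\to\overline{G}$ be defined by $\phi(g\boxtimes h)=g\cdot{}^{h}(g^{-1})\,D_\rho(G)$. Then the following hold: (i) $\phi$ is a homomorphism; (ii) there is an action of $\overline{G}$ on $G\boxtimes H$ defined by ${}^{x}(g\boxtimes h)={}^{x}g\boxtimes{}^{x}h$ for $x\in\overline{G}$; (iii) $\phi\colon G\boxtimes H\to\overline{G}$ (with the action in (ii)) is a crossed module.
   Context: All actions are left actions by automorphisms. $G$ and $H$ act on themselves and on each other through homomorphisms $\rho_G\colon G\to \mathrm{Aut}(G)$, $\rho_H\colon H\to\mathrm{Aut}(H)$, $\sigma_G\colon G\to\mathrm{Aut}(H)$, $\sigma_H\colon H\to \mathrm{Aut}(G)$ (a group need not act on itself by conjugation). For $a,b\in G\cup H$ (disjoint union), ${}^{a}b$ denotes the result of acting by $a$ on $b$. The actions are fully compatible if ${}^{({}^{a}b)}c={}^{a}\big({}^{b}({}^{a^{-1}}c)\big)$ for all $a,b,c\in G\cup H$. The box-tensor product $G\boxtimes H$ is the group generated by the symbols $g\boxtimes h$ ($g\in G$, $h\in H$) subject to the relations $gg'\boxtimes h=({}^{g}g'\boxtimes {}^{g}h)(g\boxtimes h)$ and $g\boxtimes hh'=(g\boxtimes h)({}^{h}g\boxtimes {}^{h}h')$ for all $g,g'\in G$, $h,h'\in H$. The deviational subgroup $D_\rho(G)$ is the normal closure in $G$ of $\{{}^{g}g'\cdot gg'^{-1}g^{-1}\mid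 g,g'\in G\}$, where ${}^{g}g'=\rho_G(g)(g')$. When the actions are fully compatible, $D_\rho(G)$ acts trivially on $G$ and $H$, so there are induced actions of $\overline{G}=G/D_\rho(G)$ on $G$ and $H$. A crossed module is a group homomorphism $\phi\colon A\to B$ together with an action of $B$ on $A$ such that $\phi({}^{b}a)=b\phi(a)b^{-1}$ and ${}^{\phi(a)}a'=aa'a^{-1}$ for all $b\in B$, $a,a'\in A$. *)

(* Defs.v *)
From HB Require Import structures.
From mathcomp Require Import all_boot boolp classical_sets.

Set Implicit Arguments.
Unset Strict Implicit.
Unset Printing Implicit Defensive.

Local Open Scope classical_set_scope.
Local Open Scope quotient_scope.
Local Open Scope group_scope.

(* A homomorphism A -> Aut(B), in curried form: every [aact a] is an
   automorphism of B, and composition of automorphisms is the group law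
   of Aut(B). *)
Record autAction (A B : groupType) := AutAction {
  aact :> A -> B -> B;
  aact_bij : forall a, bijective (aact a);
  aactMr : forall a, {morph aact a : x y / x * y};
  aactMl : forall a a' b, aact (a * a') b = aact a (aact a' b)
}.

Definition crossed_module (A B : groupType) (phi : A -> B)
    (act : autAction B A) : Prop :=
  [/\ {morph phi : s t / s * t},
      forall b a, phi (act b a) = b * phi a * b^-1
    & forall a a', act (phi a) a' = a * a' * a^-1].

Definition normal_subgroup (G : groupType) (N : set G) : Prop :=
  [/\ N 1, forall x y, N x -> N y -> N (x * y), forall x, N x -> N x^-1
    & forall x y, N x -> N (y * x * y^-1)].

Record normalSubgroup (G : groupType) := NormalSubgroup {
  nsg_set :> G -> Prop;
  nsg_normal : normal_subgroup nsg_set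
}.

Lemma smallest_normal_subgroup (G : groupType) (S : set G) :
  normal_subgroup (smallest (@normal_subgroup G) S).
Proof.
split=> [N [[]] //|x y Nx Ny N [nN sN]|x Nx N [nN sN]|x y Nx N [nN sN]];
  have [N1 NM NV NJ] := nN.
- by apply: NM; [apply: Nx | apply: Ny].
- by apply: NV; apply: Nx.
- by apply: NJ; apply: Nx.
Qed.

Definition normal_closure (G : groupType) (S : set G) : normalSubgroup G :=
  NormalSubgroup (smallest_normal_subgroup S).

Section QuotientGroup.
Variables (G : groupType) (N : normalSubgroup G).

Definition coset_rel : rel G := fun x y => `[< N (x^-1 * y) >].

Lemma coset_rel_refl : reflexive coset_rel.
Proof. by move=> x; apply/asboolP; rewrite mulVg; case: (nsg_normal N). Qed.

Lemma coset_rel_sym : symmetric coset_rel.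
Proof.
have [_ _ NV _] := nsg_normal N.
by move=> x y; apply/asboolP/asboolP=> /NV; rewrite invgM invgK.
Qed.

Lemma coset_rel_trans : transitive coset_rel.
Proof.
have [_ NM _ _] := nsg_normal N.
move=> y x z /asboolP Nxy /asboolP Nyz; apply/asboolP.
by have := NM _ _ Nxy Nyz; rewrite mulgA mulgK.
Qed.

Canonical coset_equiv :=
  EquivRel coset_rel coset_rel_refl coset_rel_sym coset_rel_trans.

Definition quotientGroup : Type := {eq_quot coset_equiv}.
HB.instance Definition _ := Choice.on quotientGroup.

Definition qcoset (x : G) : quotientGroup := \pi_{eq_quot coset_equiv} x.
Definition qrepr (X : quotientGroup) : G := repr (X : {eq_quot coset_equiv}).

Lemma qreprK : cancel qrepr qcoset.
Proof. by move=> X; apply: reprK. Qed.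

Lemma qcosetP x y : qcoset x = qcoset y <-> N (x^-1 * y).
Proof. by split=> [/eqmodP/asboolP|Nxy] //; apply/eqmodP/asboolP. Qed.

Lemma qreprP x : N (x^-1 * qrepr (qcoset x)).
Proof. by apply/qcosetP; rewrite qreprK. Qed.

Definition qmul (X Y : quotientGroup) := qcoset (qrepr X * qrepr Y).
Definition qone : quotientGroup := qcoset 1.
Definition qinv (X : quotientGroup) := qcoset (qrepr X)^-1.

Lemma qmulE x y : qmul (qcoset x) (qcoset y) = qcoset (x * y).
Proof.
have [_ NM _ NJ] := nsg_normal N.
apply/esym/qcosetP; rewrite invgM.
have := NM _ _ (NJ _ y^-1 (qreprP x)) (qreprP y).
by rewrite invgK !mulgA mulgK.
Qed.

Lemma qmulA : associative qmul.
Proof.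
by move=> X Y Z; rewrite -[X]qreprK -[Y]qreprK -[Z]qreprK !qmulE mulgA.
Qed.

Lemma qmul1 : left_id qone qmul.
Proof. by move=> X; rewrite -[X]qreprK qmulE mul1g. Qed.

Lemma qmulr1 : right_id qone qmul.
Proof. by move=> X; rewrite -[X]qreprK qmulE mulg1. Qed.

Lemma qmulV : left_inverse qone qinv qmul.
Proof. by move=> X; rewrite -{2}[X]qreprK qmulE mulVg. Qed.

Lemma qmulrV : right_inverse qone qinv qmul.
Proof. by move=> X; rewrite -{1}[X]qreprK qmulE mulgV. Qed.

HB.instance Definition _ :=
  isGroup.Build quotientGroup qmulA qmul1 qmulr1 qmulV qmulrV.

Lemma qcosetM : {morph qcoset : x y / x * y}.
Proof. by move=> x y; rewrite -qmulE. Qed.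

Section InducedAction.
Variables (B : groupType) (act : autAction G B).
Hypothesis actN : forall n, N n -> act n =1 id.

Definition qact (X : quotientGroup) : B -> B := act (qrepr X).

Lemma qactE x : qact (qcoset x) =1 act x.
Proof.
by move=> b; rewrite /qact -[qrepr _](mulVKg x) aactMl (actN (qreprP x)).
Qed.

Lemma qact_bij X : bijective (qact X).
Proof. exact: aact_bij. Qed.

Lemma qactMr X : {morph qact X : x y / x * y}.
Proof. exact: aactMr. Qed.

Lemma qactMl X Y b : qact (X * Y) b = qact X (qact Y b).
Proof. by rewrite -[X]qreprK -[Y]qreprK -qcosetM !qactE aactMl. Qed.

Definition induced_action : autAction quotientGroup B :=
  AutAction qact_bij qactMr qactMl.

End InducedAction.
End QuotientGroup.

(* The group presented by generators X and relations R: words in the letters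
   (x, false) for x and (x, true) for x^-1, modulo the smallest congruence
   that contains R and makes the two letters of each x mutually inverse. *)

Section PresentedGroup.
Variables (X : choiceType) (R : seq (X * bool) -> seq (X * bool) -> Prop).

Inductive pres_eq : seq (X * bool) -> seq (X * bool) -> Prop :=
| pres_rel u v of R u v : pres_eq u v
| pres_cancel x b : pres_eq [:: (x, b); (x, ~~ b)] [::]
| pres_cat u u' v v' of pres_eq u u' & pres_eq v v' :
    pres_eq (u ++ v) (u' ++ v')
| pres_refl u : pres_eq u u
| pres_sym u v of pres_eq u v : pres_eq v u
| pres_trans u v w of pres_eq u v & pres_eq v w : pres_eq u w.

Definition pres_eqb : rel (seq (X * bool)) := fun u v => `[< pres_eq u v >].

Lemma pres_eqb_refl : reflexive pres_eqb.
Proof. by move=> u; apply/asboolP; apply: pres_refl. Qed.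

Lemma pres_eqb_sym : symmetric pres_eqb.
Proof. by move=> u v; apply/asboolP/asboolP; apply: pres_sym. Qed.

Lemma pres_eqb_trans : transitive pres_eqb.
Proof.
by move=> v u w /asboolP uv /asboolP vw; apply/asboolP; apply: pres_trans uv vw.
Qed.

Canonical pres_equiv :=
  EquivRel pres_eqb pres_eqb_refl pres_eqb_sym pres_eqb_trans.

Definition presentedGroup : Type := {eq_quot pres_equiv}.
HB.instance Definition _ := Choice.on presentedGroup.

Definition pclass (u : seq (X * bool)) : presentedGroup :=
  \pi_{eq_quot pres_equiv} u.
Definition prepr (s : presentedGroup) : seq (X * bool) :=
  repr (s : {eq_quot pres_equiv}).

Lemma preprK : cancel prepr pclass.
Proof. by move=> s; apply: reprK. Qed.

Lemma pclassP u v : pclass u = pclass v <-> pres_eq u v.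
Proof. by split=> [/eqmodP/asboolP|uv] //; apply/eqmodP/asboolP. Qed.

Definition winv (u : seq (X * bool)) : seq (X * bool) :=
  rev [seq (l.1, ~~ l.2) | l <- u].

Lemma winvK : involutive winv.
Proof.
move=> u; rewrite /winv map_rev revK -map_comp -[RHS]map_id.
by apply: eq_map => -[x b] /=; rewrite negbK.
Qed.

Lemma winvVr u : pres_eq (u ++ winv u) [::].
Proof.
elim: u => [|[x b] u IHu]; first exact: pres_refl.
rewrite /winv map_cons rev_cons -cats1 -/(winv u) -cat1s -catA [u ++ _]catA.
apply: pres_trans (pres_cancel x b).
rewrite -[[:: (x, b); _]]/([:: (x, b)] ++ [::] ++ [:: (x, ~~ b)]).
apply: pres_cat; first exact: pres_refl.
by apply: pres_cat => //; apply: pres_refl.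
Qed.

Definition pmul (s t : presentedGroup) := pclass (prepr s ++ prepr t).
Definition pone : presentedGroup := pclass [::].
Definition pinv (s : presentedGroup) := pclass (winv (prepr s)).

Lemma pmulE u v : pmul (pclass u) (pclass v) = pclass (u ++ v).
Proof. by apply/pclassP; apply: pres_cat; apply/pclassP; rewrite preprK. Qed.

Lemma pmulA : associative pmul.
Proof.
by move=> s t r; rewrite -[s]preprK -[t]preprK -[r]preprK !pmulE catA.
Qed.

Lemma pmul1 : left_id pone pmul.
Proof. by move=> s; rewrite -[s]preprK pmulE. Qed.

Lemma pmulr1 : right_id pone pmul.
Proof. by move=> s; rewrite -[s]preprK pmulE cats0. Qed.

Lemma pmulrV : right_inverse pone pinv pmul.
Proof. by move=> s; rewrite -{1}[s]preprK pmulE; apply/pclassP/winvVr. Qed.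

Lemma pmulV : left_inverse pone pinv pmul.
Proof.
move=> s; rewrite -{2}[s]preprK pmulE; apply/pclassP.
by rewrite -{2}[prepr s]winvK; apply: winvVr.
Qed.

HB.instance Definition _ :=
  isGroup.Build presentedGroup pmulA pmul1 pmulr1 pmulV pmulrV.

Definition pgen (x : X) : presentedGroup := pclass [:: (x, false)].

Lemma pclassM u v : pclass (u ++ v) = pclass u * pclass v.
Proof. by rewrite -pmulE. Qed.

End PresentedGroup.

Record mutualActions (G H : groupType) := MutualActions {
  rhoG : autAction G G;
  rhoH : autAction H H;
  sigmaG : autAction G H;
  sigmaH : autAction H G
}.

Section BoxTensor.
Variables (G H : groupType) (M : mutualActions G H).

Definition sum_act (a b : G + H) : G + H :=
  match a, b with
  | inl g, inl g' => inl (rhoG M g g')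
  | inl g, inr h => inr (sigmaG M g h)
  | inr h, inl g => inl (sigmaH M h g)
  | inr h, inr h' => inr (rhoH M h h')
  end.

Definition sum_inv (a : G + H) : G + H :=
  match a with inl g => inl g^-1 | inr h => inr h^-1 end.

Definition fully_compatible : Prop := forall a b c : G + H,
  sum_act (sum_act a b) c = sum_act a (sum_act b (sum_act (sum_inv a) c)).

Definition deviational_subgroup : normalSubgroup G :=
  normal_closure
    [set x | exists g g', x = rhoG M g g' * (g * g'^-1 * g^-1)].

Lemma deviational_act_id (B : groupType) (act : autAction G B) :
    (forall g g' c, act (rhoG M g g') c = act g (act g' (act g^-1 c))) ->
  forall n, deviational_subgroup n -> act n =1 id.
Proof.
have act1 b : act 1 b = b.
  by apply: (bij_inj (aact_bij act 1)); rewrite -aactMl mulg1.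
move=> actP n; apply: (smallest_sub (X := [set n | act n =1 id])).
  split=> [|x y /= xK yK b|x /= xK b|x y /= xK b] //=.
  - by rewrite aactMl yK xK.
  - by rewrite -[LHS]xK -aactMl mulgV act1.
  - by rewrite !aactMl xK -aactMl mulgV act1.
by move=> _ [g [g' ->]] c /=; rewrite aactMl actP -!aactMl !mulgA mulgVK
  -(mulgA g) mulgV mulg1 mulgV act1.
Qed.

Hypothesis hM : fully_compatible.

Lemma deviational_actG n : deviational_subgroup n -> rhoG M n =1 id.
Proof.
by apply: deviational_act_id => g g' c; case: (hM (inl g) (inl g') (inl c)).
Qed.

Lemma deviational_actH n : deviational_subgroup n -> sigmaG M n =1 id.
Proof.
by apply: deviational_act_id => g g' c; case: (hM (inl g) (inl g') (inr c)).
Qed.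

Definition bar_actG : autAction (quotientGroup deviational_subgroup) G :=
  induced_action deviational_actG.

Definition bar_actH : autAction (quotientGroup deviational_subgroup) H :=
  induced_action deviational_actH.

Definition box_sym (g : G) (h : H) : (G * H) * bool := ((g, h), false).

Inductive box_relation : seq ((G * H) * bool) -> seq ((G * H) * bool) -> Prop :=
| box_relMl g g' h :
    box_relation [:: box_sym (g * g') h]
                 [:: box_sym (rhoG M g g') (sigmaG M g h); box_sym g h]
| box_relMr g h h' :
    box_relation [:: box_sym g (h * h')]
                 [:: box_sym g h; box_sym (sigmaH M h g) (rhoH M h h')].

Definition boxTensor : groupType := presentedGroup box_relation.

Definition box (g : G) (h : H) : boxTensor := pgen box_relation (g, h).

End BoxTensor.

(* Main.v *)
Require Import Defs.
From mathcomp Require Import all_boot.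
From mathcomp Require Import boolp.

Set Implicit Arguments.
Unset Strict Implicit.
Unset Printing Implicit Defensive.

Local Open Scope group_scope.

(* Expanding (g g') [x] (h h') by the two defining relations in either order
   and cancelling the common outer factors gives
     ^g(^h t) (g [x] h) = (g [x] h) ^h(^g t)   for t = g' [x] h',
   hence conjugation by g [x] h is the action of the commutator g h g^-1 h^-1.
   By compatibility ^h(g^-1) acts as h g^-1 h^-1, so that commutator acts as
   g ^h(g^-1), which represents phi (g [x] h): this is the Peiffer identity.
   The remaining claims are checks on generators, using that modulo D_rho(G)
   the action of G on itself becomes conjugation. *)

(** * Homomorphisms, actions by automorphisms, and cosets *)

Section GroupMorphism.
Variables (A B : groupType) (f : A -> B).
Hypothesis fM : {morph f : x y / x * y}.

Lemma morph_group1 : f 1 = 1.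
Proof. by apply: (mulgI (f 1)); rewrite -fM !mulg1. Qed.

Lemma morph_groupV : {morph f : x / x^-1}.
Proof. by move=> x; apply: (mulgI (f x)); rewrite -fM !mulgV morph_group1. Qed.

End GroupMorphism.

Section AutAction.
Variables (A B : groupType) (act : autAction A B).

Lemma aact1 b : act 1 b = b.
Proof. by apply: (bij_inj (aact_bij act 1)); rewrite -aactMl mulg1. Qed.

Lemma aactK a : cancel (act a) (act a^-1).
Proof. by move=> b; rewrite -aactMl mulVg aact1. Qed.

Lemma aactVK a : cancel (act a^-1) (act a).
Proof. by move=> b; rewrite -aactMl mulgV aact1. Qed.

Lemma aactV a : {morph act a : b / b^-1}.
Proof. by apply: morph_groupV => x y; rewrite aactMr. Qed.

End AutAction.

(** Apart from the map itself, all fields are propositions, hence equal by proof irrelevance. This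
    reduces uniqueness of the action to a pointwise check. *)
Lemma autAction_eq (A B : groupType) (act1 act2 : autAction A B) :
  (forall a, act1 a =1 act2 a) -> act1 = act2.
Proof.
case: act1 act2 => [f fb fr fl] [g gb gr gl] /= fg.
have {}fg : f = g by apply: funext => a; apply: funext.
by case: _ / fg in gb gr gl *; congr AutAction; apply: Prop_irrelevance.
Qed.

(** Inverting and conjugating by [x^-1] turns the right quotient, the shape of the generators of
    [D], into the left quotient [x^-1 * y] used by [coset_rel]. *)
Lemma qcoset_eq_div (G : groupType) (N : normalSubgroup G) (x y : G) :
  N (x * y^-1) -> qcoset N x = qcoset N y.
Proof.
have [_ _ NV NJ] := nsg_normal N => /NV/(NJ _ x^-1).
by rewrite invgM !invgK mulgA mulgVK => Nxy; apply/qcosetP.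
Qed.

(** * Induction and universal property for presented groups *)

Section PresentedGroupTheory.
Variables (X : choiceType) (R : seq (X * bool) -> seq (X * bool) -> Prop).

Lemma pgenV x : pclass R [:: (x, true)] = (pgen R x)^-1.
Proof.
apply: (mulgI (pgen R x)); rewrite mulgV -pclassM.
exact/pclassP/(@pres_cancel _ _ x false).
Qed.

Lemma presented_ind (P : presentedGroup R -> Prop) :
    P 1 -> (forall x, P (pgen R x)) ->
    (forall s t, P s -> P t -> P (s * t)) -> (forall s, P s -> P s^-1) ->
  forall s, P s.
Proof.
move=> P1 Pg PM PV s; rewrite -[s]preprK; elim: (prepr s) => [//|[x b] u IHu].
rewrite -cat1s pclassM; apply: PM => //.
by case: b; [rewrite pgenV; apply: PV | ]; apply: Pg.
Qed.

Lemma presented_morph_eq (K : groupType) (f1 f2 : presentedGroup R -> K) :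
    {morph f1 : s t / s * t} -> {morph f2 : s t / s * t} ->
  (forall x, f1 (pgen R x) = f2 (pgen R x)) -> f1 =1 f2.
Proof.
move=> f1M f2M f12; apply: presented_ind => //= [|s t IHs IHt|s IHs].
- by rewrite !morph_group1.
- by rewrite f1M f2M IHs IHt.
- by rewrite !morph_groupV // IHs.
Qed.

Section Lift.
Variables (K : groupType) (f : X -> K).

Definition word_eval (u : seq (X * bool)) : K :=
  \prod_(l <- u) (if l.2 then (f l.1)^-1 else f l.1).

Hypothesis fR : forall u v, R u v -> word_eval u = word_eval v.

Lemma word_eval_pres_eq u v : pres_eq R u v -> word_eval u = word_eval v.
Proof.
elim=> {u v} [u v /fR //|x b|u u' v v' _ IHu _ IHv|//|//|u v w _ -> _ -> //].
- rewrite /word_eval !big_cons big_nil mulg1 /=.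
  by case: b; rewrite /= ?mulVg ?mulgV.
- by rewrite /word_eval !big_cat; congr (_ * _).
Qed.

Definition presented_lift (s : presentedGroup R) : K := word_eval (prepr s).

Lemma presented_liftE u : presented_lift (pclass R u) = word_eval u.
Proof. by apply/word_eval_pres_eq/pclassP; rewrite preprK. Qed.

Lemma presented_lift_gen x : presented_lift (pgen R x) = f x.
Proof. by rewrite presented_liftE /word_eval big_seq1. Qed.

Lemma presented_liftM : {morph presented_lift : s t / s * t}.
Proof.
move=> s t; rewrite -[s]preprK -[t]preprK -pclassM !presented_liftE.
by rewrite /word_eval big_cat.
Qed.

End Lift.
End PresentedGroupTheory.

(** * Relations and universal property of the box tensor *)

Section BoxTensorTheory.
Variables (G H : groupType) (M : mutualActions G H).

Local Notation D := (deviational_subgroup M).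
Local Notation rG := (rhoG M).
Local Notation rH := (rhoH M).
Local Notation sG := (sigmaG M).
Local Notation sH := (sigmaH M).

Lemma boxMl g g' h : box M (g * g') h = box M (rG g g') (sG g h) * box M g h.
Proof. by rewrite /box -pclassM; apply/pclassP/pres_rel/box_relMl. Qed.

Lemma boxMr g h h' : box M g (h * h') = box M g h * box M (sH h g) (rH h h').
Proof. by rewrite /box -pclassM; apply/pclassP/pres_rel/box_relMr. Qed.

Section BoxLift.
Variables (K : groupType) (f : G -> H -> K).
Hypothesis fMl : forall g g' h, f (g * g') h = f (rG g g') (sG g h) * f g h.
Hypothesis fMr : forall g h h', f g (h * h') = f g h * f (sH h g) (rH h h').

Lemma box_lift_subproof u v : box_relation M u v ->
  word_eval (fun p => f p.1 p.2) u = word_eval (fun p => f p.1 p.2) v.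
Proof.
by case=> *; rewrite /word_eval !big_cons !big_nil /= !mulg1; auto.
Qed.

(** [fMl] and [fMr] are the two defining relations read in [K], so evaluation of words descends to
    the quotient. *)
Lemma box_lift : exists phi : boxTensor M -> K,
  {morph phi : s t / s * t} /\ forall g h, phi (box M g h) = f g h.
Proof.
exists (@presented_lift _ (box_relation M) _ (fun p => f p.1 p.2)); split.
  exact/presented_liftM/box_lift_subproof.
by move=> g h; rewrite presented_lift_gen //; apply: box_lift_subproof.
Qed.

End BoxLift.

Lemma box_morph_eq (K : groupType) (f1 f2 : boxTensor M -> K) :
    {morph f1 : s t / s * t} -> {morph f2 : s t / s * t} ->
  (forall g h, f1 (box M g h) = f2 (box M g h)) -> f1 =1 f2.
Proof.
by move=> f1M f2M f12; apply: presented_morph_eq => // -[g h]; apply: f12.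
Qed.

(** The right quotient of the two representatives is one of the elements whose normal closure is
    [D]. *)
Lemma qcoset_rho g x : qcoset D (rG g x) = qcoset D (g * x * g^-1).
Proof.
apply: qcoset_eq_div => N [_]; apply; exists g, x.
by rewrite !invgM invgK !mulgA.
Qed.

(** * Consequences of full compatibility, and existence of phi *)

Hypothesis hM : fully_compatible M.

(** Here and in the next three lemmas, compatibility is applied to an argument already of the form
    ^g c, so the inner g^-1 cancels: all actions are equivariant under [g]. *)
Lemma rhoG_rhoG g x y : rG (rG g x) (rG g y) = rG g (rG x y).
Proof. by case: (hM (inl g) (inl x) (inl (rG g y))) => ->; rewrite aactK. Qed.

Lemma sigmaG_rhoG g x h : sG (rG g x) (sG g h) = sG g (sG x h).
Proof. by case: (hM (inl g) (inl x) (inr (sG g h))) => ->; rewrite aactK. Qed.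

Lemma sigmaH_sigmaG g h x : sH (sG g h) (rG g x) = rG g (sH h x).
Proof. by case: (hM (inl g) (inr h) (inl (rG g x))) => ->; rewrite aactK. Qed.

Lemma rhoH_sigmaG g h k : rH (sG g h) (sG g k) = sG g (rH h k).
Proof. by case: (hM (inl g) (inr h) (inr (sG g k))) => ->; rewrite aactK. Qed.

Lemma rhoG_sigmaH h g x : rG (sH h g) x = sH h (rG g (sH h^-1 x)).
Proof. by case: (hM (inr h) (inl g) (inl x)). Qed.

Lemma sigmaG_sigmaH h g k : sG (sH h g) k = rH h (sG g (rH h^-1 k)).
Proof. by case: (hM (inr h) (inl g) (inr k)). Qed.

Lemma sigmaH_rhoH h k x : sH (rH h k) (sH h x) = sH h (sH k x).
Proof. by case: (hM (inr h) (inr k) (inl (sH h x))) => ->; rewrite aactK. Qed.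

Lemma box_phi_exists : exists phi : boxTensor M -> quotientGroup D,
  {morph phi : s t / s * t} /\
  forall g h, phi (box M g h) = qcoset D (g * sH h g^-1).
Proof.
apply: box_lift => [g g' h|g h h'].
  (* The first factor on the right is the coset of ^g(g' ^h(g'^-1)); modulo [D] this is a conjugate
     by [g], and the product telescopes. *)
  rewrite -(aactV rG) sigmaH_sigmaG -(aactMr rG) qcoset_rho -qcosetM.
  by rewrite invgM aactMr !mulgA mulgVK.
(* The second relation holds already in [G]: ^h(g^-1) cancels against ^h g. *)
rewrite -(aactV sH) sigmaH_rhoH -qcosetM !mulgA -[in RHS](mulgA g).
by rewrite -aactMr mulVg (morph_group1 (aactMr sH h)) mulg1 aactMl.
Qed.

(** * The diagonal action on the box tensor *)

Definition box_act_spec (g : G) (f : boxTensor M -> boxTensor M) :=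
  {morph f : s t / s * t} /\
  forall x h, f (box M x h) = box M (rG g x) (sG g h).

(** By equivariance, [g] carries each defining relation to the same relation with translated
    entries. *)
Lemma box_act_exists g : exists f, box_act_spec g f.
Proof.
apply: box_lift => [x y h|x h k].
  by rewrite aactMr boxMl rhoG_rhoG sigmaG_rhoG.
by rewrite aactMr boxMr sigmaH_sigmaG rhoH_sigmaG.
Qed.

Lemma box_act_inv g f f' : box_act_spec g f -> box_act_spec g^-1 f' ->
  cancel f f'.
Proof.
move=> [fM fE] [f'M f'E]; apply: box_morph_eq => // [s t|x h].
  by rewrite fM f'M.
by rewrite fE f'E !aactK.
Qed.

Definition box_act (g : G) : boxTensor M -> boxTensor M :=
  projT1 (cid (box_act_exists g)).

Lemma box_actP g : box_act_spec g (box_act g).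
Proof. exact: (projT2 (cid (box_act_exists g))). Qed.

Lemma box_act_bij g : bijective (box_act g).
Proof.
exists (box_act g^-1); first exact: box_act_inv (box_actP _) (box_actP _).
by apply: (@box_act_inv g^-1); rewrite ?invgK; apply: box_actP.
Qed.

Lemma box_actMl a b s : box_act (a * b) s = box_act a (box_act b s).
Proof.
have [aM aE] := box_actP a; have [bM bE] := box_actP b.
have [abM abE] := box_actP (a * b).
apply: (box_morph_eq _ (f2 := box_act a \o box_act b)) => // [s' t|x h] /=.
  by rewrite bM aM.
by rewrite abE bE aE !aactMl.
Qed.

Definition box_action : autAction G (boxTensor M) :=
  AutAction box_act_bij (fun g => (box_actP g).1) box_actMl.

Lemma box_actE g x h : box_action g (box M x h) = box M (rG g x) (sG g h).
Proof. exact: (box_actP g).2. Qed.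

Lemma deviational_act_box n : D n -> box_action n =1 id.
Proof.
move=> Dn; apply: box_morph_eq => // [|x h]; first exact: aactMr.
by rewrite box_actE (deviational_actG hM Dn) (deviational_actH hM Dn).
Qed.

(** * The crossed module identities *)

Lemma box_exchange g h g' h' :
  box M (rG g (sH h g')) (sG g (rH h h')) * box M g h =
  box M g h * box M (sH h (rG g g')) (rH h (sG g h')).
Proof.
have := boxMr (g * g') h h'; rewrite boxMl aactMr boxMr (boxMr g).
rewrite (boxMl g g' h) aactMr (boxMl (sH h g)) sigmaH_sigmaG rhoH_sigmaG.
(* The factors cancelled are [box M (sH h g) (rH h h')] on the right, then
   [box M (rG g g') (sG g h)] on the left. *)
rewrite rhoG_sigmaH aactK sigmaG_sigmaH aactK !mulgA => /mulIg.
by rewrite -!mulgA => /mulgI.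
Qed.

Lemma box_act_gen g h g' h' :
  box_action (g * sH h g^-1) (box M g' h') =
  box M g h * box M g' h' * (box M g h)^-1.
Proof.
(* These arguments make the second factor on the right exactly [box M g' h'], leaving the commutator
   of [g] and [h] acting on the left. *)
have := box_exchange g h (rG g^-1 (sH h^-1 g')) (sG g^-1 (rH h^-1 h')).
rewrite !aactVK => <-; rewrite mulgK box_actE !aactMl.
by rewrite rhoG_sigmaH sigmaG_sigmaH.
Qed.

Lemma box_phi_equivariant (phi : boxTensor M -> quotientGroup D) :
    {morph phi : s t / s * t} ->
    (forall g h, phi (box M g h) = qcoset D (g * sH h g^-1)) ->
  forall x s, phi (box_action x s) = qcoset D x * phi s * (qcoset D x)^-1.
Proof.
move=> phiM phiE x.
apply: box_morph_eq => [s t|s t|g h]; first by rewrite aactMr phiM.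
  by rewrite phiM !mulgA mulgVK.
rewrite box_actE !phiE -(aactV rG) sigmaH_sigmaG -(aactMr rG) qcoset_rho.
by rewrite !qcosetM (morph_groupV (@qcosetM _ D)).
Qed.

Lemma box_peiffer (phi : boxTensor M -> quotientGroup D)
    (act : autAction (quotientGroup D) (boxTensor M)) :
    {morph phi : s t / s * t} ->
    (forall g h, phi (box M g h) = qcoset D (g * sH h g^-1)) ->
    (forall x, act (qcoset D x) =1 box_action x) ->
  forall s t, act (phi s) t = s * t * s^-1.
Proof.
move=> phiM phiE actE.
apply: presented_ind => [t|[g h]|s s' IHs IHs' t|s IHs t].
- by rewrite (morph_group1 phiM) aact1 mul1g invg1 mulg1.
- apply: box_morph_eq => [s t|s t|g' h'].
  + exact: aactMr.
  + by rewrite !mulgA mulgVK.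
  + by rewrite -[pgen _ _]/(box M g h) phiE actE box_act_gen.
- by rewrite phiM aactMl IHs IHs' invgM !mulgA.
(* The hypothesis at this conjugate writes [t] as an image under [act (phi s)], which
   [act (phi s^-1)] then undoes. *)
- have := IHs (s^-1 * t * s); rewrite !mulgA mulgK mulgV mul1g => {1}<-.
  by rewrite (morph_groupV phiM) aactK invgK.
Qed.

End BoxTensorTheory.

Theorem proposition3p7 (G H : groupType) (M : mutualActions G H)
    (hM : fully_compatible M) :
  let D := deviational_subgroup M in
  let isPhi (phi : boxTensor M -> quotientGroup D) :=
    {morph phi : s t / s * t} /\
    forall g h, phi (box M g h) = qcoset D (g * sigmaH M h g^-1) in
  let isBarAction (act : autAction (quotientGroup D) (boxTensor M)) :=
    forall x g h, act x (box M g h) = box M (bar_actG hM x g) (bar_actH hM x h) in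
  [/\ exists! phi, isPhi phi,
      exists! act, isBarAction act
    & forall phi act, isPhi phi -> isBarAction act -> crossed_module phi act].
Proof.
move=> D isPhi isBarAction.
have actU act1 act2 : isBarAction act1 -> isBarAction act2 -> act1 = act2.
  move=> act1E act2E; apply: autAction_eq => x.
  by apply: box_morph_eq => [||g h]; rewrite ?act1E ?act2E //; apply: aactMr.
have actE : isBarAction (induced_action (deviational_act_box hM)).
  by move=> x g h; apply: box_actE.
split.
- have [phi phiP] := box_phi_exists hM.
  exists phi; split=> // psi [psiM psiE]; have [phiM phiE] := phiP.
  by apply/funext/box_morph_eq => // g h; rewrite phiE psiE.
- exists (induced_action (deviational_act_box hM)); split=> // act.
  exact: actU.
(* Uniqueness allows replacing [act] by the induced action, computed on coset representatives. *)
- move=> phi act [phiM phiE] /(actU _ _ actE) <-; split=> // [x s|].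
    by rewrite -[in RHS](qreprK x); apply: box_phi_equivariant.
  by apply: box_peiffer => // x; apply: qactE (deviational_act_box hM) _.
Qed.
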